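(* Let $0<p_l<p_u$ and put $p_b=\sqrt{p_l p_u}$. (i) For every $L>0$, let $(x,y)$ be the token amounts held by a concentrated-liquidity position of liquidity $L$ on the price range $[p_l,p_u]$ when the marginal price is $p_b$, and let $L_0=\sqrt{xy}$ be the liquidity obtained by depositing these same amounts in a constant product pool. Then $$\frac{L_0}{L}=1-\left(\frac{p_l}{p_u}\right)^{1/4},$$ i.e. concentrated liquidity on $[p_l,p_u]$ is $\dfrac{1}{1-(p_l/p_u)^{1/4}}$ times more capital efficient than the constant product pool. (ii) Among all leverage ratios $l>1$ for which a margin liquidity-providing position with leverage ratio $l$ opened at marginal price $p_b$ is not liquidated at any marginal price in $[p_l,p_u]$, the maximum is $$l_{\max}=\frac{\left(\frac{p_u}{p_l}\right)^{1/2}+1}{\left(\left(\frac{p_u}{p_l}\right)^{1/4}-1\right)^2}.$$ Consequently, in the best case, margin liquidity that stays open on $[p_l,p_u]$ is $l_{\max}$ times more capital efficient than the constant product pool.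
   Context: There are two tokens $X$ and $Y$. Swap fees are disregarded. All prices and amounts are real numbers. Constant product pool (Uniswap V2): a pool holding amounts $x,y>0$ of $X$ and $Y$ has liquidity $\sqrt{xy}$, which is unchanged by trades. The marginal price of $Y$ with respect to $X$ is $p=-dx/dy$ along the curve $xy=\text{const}$, that is $p=x/y$. Hence a deposit with liquidity $L_0$ holds $(x,y)=(L_0\sqrt p,\;L_0/\sqrt p)$ at marginal price $p$. Deposits are made in the ratio $x/y=p$, where $p$ is the current marginal price. Concentrated liquidity (Uniswap V3) of liquidity $L>0$ on $[p_l,p_u]$: the held amounts $x,y\ge 0$ satisfy $(x+L\sqrt{p_l})(y+L/\sqrt{p_u})=L^2$, and the marginal price of $Y$ with respect to $X$ is $p=-dx/dy=(x+L\sqrt{p_l})^2/L^2$. Divergence loss: if $(a_0,b_0)$ is deposited in a constant product pool at marginal price $p_0=a_0/b_0$, and at marginal price $p_1$ the deposit has become $(a_1,b_1)$ with $a_1b_1=a_0b_0$ and $a_1/b_1=p_1$, then the magnitude of the divergence loss (in units of $X$) is $(a_0+p_1b_0)-(a_1+p_1b_1)$. Margin liquidity-providing position with leverage ratio $l$ opened at marginal price $p_0$: with collateral $(\Delta x_0,\Delta y_0)$, where $\Delta x_0,\Delta y_0>0$ and $\Delta x_0/\Delta y_0=p_0$, the borrowed amounts $(l\Delta x_0,l\Delta y_0)$ are deposited in the constant product pool. At marginal price $p_1$ the collateral is worth $\Delta x_0+p_1\Delta y_0$ in units of $X$. The position is liquidated at marginal price $p_1$ when the magnitude of the divergence loss of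 the borrowed deposit exceeds this collateral value. Capital efficiency relative to the constant product pool: the ratio of the liquidity provided on $[p_l,p_u]$ by the given mechanism to the liquidity provided by the constant product pool, when the same assets (valued and deposited at marginal price $p_b$) are used. For margin liquidity the assets used are the collateral, and the liquidity provided is that of the borrowed deposit $(l\Delta x_0,l\Delta y_0)$. *)

(* Defs.v *)
From Stdlib Require Import Reals.
From Coquelicot Require Import Coquelicot.
Open Scope R_scope.

(* Amounts are written (x, y): x of token X, y of token Y.
   Prices are prices of Y with respect to X, values are in units of X. *)

Definition is_maximum (E : R -> Prop) (m : R) : Prop :=
  E m /\ is_upper_bound E m.

Definition asset_value (p x y : R) : R := x + p * y.

(* p = - dx/dy at the point (x, y) of the curve: x is expressed near y as a
   function f of the amount of Y. *)
Definition marginal_price (curve : R -> R -> Prop) (x y p : R) : Prop :=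
  exists f : R -> R,
    f y = x /\ locally y (fun t => curve (f t) t) /\ is_derive f y (- p).

Definition cp_liquidity (x y : R) : R := sqrt (x * y).

Definition cp_curve (L x y : R) : Prop :=
  0 < x /\ 0 < y /\ cp_liquidity x y = L.

Definition cp_holds (L p x y : R) : Prop :=
  cp_curve L x y /\ marginal_price (cp_curve L) x y p.

(* Amounts that can be deposited when the current marginal price is p. *)
Definition cp_deposit (p x y : R) : Prop :=
  0 < x /\ 0 < y /\ x / y = p.

(* The signs of x and y are not part of the curve, so that the marginal price
   also makes sense at the end points of the price range, where x or y is 0. *)
Definition cl_curve (L pl pu x y : R) : Prop :=
  (x + L * sqrt pl) * (y + L / sqrt pu) = L ^ 2.

Definition cl_holds (L pl pu p x y : R) : Prop :=
  0 <= x /\ 0 <= y /\ cl_curve L pl pu x y /\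
  marginal_price (cl_curve L pl pu) x y p.

(* d is the magnitude of the divergence loss at marginal price p1 of the
   deposit (a0, b0); the deposit has become (a1, b1) at unchanged liquidity. *)
Definition divergence_loss (a0 b0 p1 d : R) : Prop :=
  exists a1 b1 : R,
    cp_holds (cp_liquidity a0 b0) p1 a1 b1 /\
    d = asset_value p1 a0 b0 - asset_value p1 a1 b1.

(* (dx, dy) is the collateral, (l * dx, l * dy) the borrowed deposit. *)
Definition liquidated (l dx dy p1 : R) : Prop :=
  exists d : R,
    divergence_loss (l * dx) (l * dy) p1 d /\ d > asset_value p1 dx dy.

(* The opening price p0 enters through cp_deposit p0 dx dy. *)
Definition margin_stays_open (p0 l dx dy pl pu : R) : Prop :=
  cp_deposit p0 dx dy /\
  forall p1 : R, pl <= p1 <= pu -> ~ liquidated l dx dy p1.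

(* e is the ratio of the liquidity L, provided by some mechanism using the
   assets (x, y), to that of the constant product deposit (u, v) made at
   marginal price p with assets of the same value. *)
Definition capital_efficiency (p L x y e : R) : Prop :=
  exists u v : R,
    cp_deposit p u v /\ asset_value p u v = asset_value p x y /\
    e = L / cp_liquidity u v.

(* Main.v *)
Require Import Defs.
From Stdlib Require Import Reals Lra.
From Coquelicot Require Import Coquelicot.
Open Scope R_scope.

(** Put a = pl^(1/4) and b = pu^(1/4), so that sqrt pb = a b.  A concentrated
    position at price pb holds (L a (b - a), L (b - a) / (a b^2)), a pair in the
    ratio pb whose geometric mean is L (1 - a / b).  A borrowed deposit
    (l dx, l dy) opened at price s0^2 suffers at price s^2 the divergence loss
    l dy (s - s0)^2, against a collateral worth dy (s0^2 + s^2); the ratio of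
    the two is largest at both end points s = a^2 and s = b^2, where the
    position survives exactly when l <= (a^2 + b^2) / (b - a)^2. *)

(** * Marginal prices on shifted hyperbolas *)

(** Near [y] the curve is the graph of one explicit function, so every witness [f] agrees with it
    locally and shares its derivative. Both pool types are instances: [c = d = 0], and the shift by
    the virtual reserves. *)
Lemma marginal_price_hyperbola (curve : R -> R -> Prop) (c d K x y p : R) :
  y + d <> 0 ->
  locally y (fun t => forall z, curve z t <-> z = K / (t + d) - c) ->
  curve x y ->
  (marginal_price curve x y p <-> p = K / (y + d) ^ 2).
Proof.
intros hyd hloc hxy.
assert (hder : is_derive (fun t => K / (t + d) - c) y (- (K / (y + d) ^ 2))).
{ auto_derive; [exact hyd | field; exact hyd]. }
split.
- intros [f [hf [hcurve hf']]].
  assert (hf'' : is_derive f y (- (K / (y + d) ^ 2))).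
  { apply (is_derive_ext_loc (fun t => K / (t + d) - c)); [|exact hder].
    generalize (filter_and _ _ hloc hcurve); apply filter_imp.
    intros t [h1 h2]; symmetry; apply h1, h2. }
  apply is_derive_unique in hf'; apply is_derive_unique in hf''; lra.
- intros ->; exists (fun t => K / (t + d) - c); split; [|split].
  + symmetry; apply (locally_singleton _ _ hloc), hxy.
  + revert hloc; apply filter_imp; intros t h; apply h; reflexivity.
  + exact hder.
Qed.

Lemma sqr_div_sqr_unique (L s z : R) :
  0 < L -> 0 < s -> 0 < z -> s ^ 2 = L ^ 2 / z ^ 2 -> z = L / s.
Proof.
intros hL hs hz h.
assert (hsz : (s * z) ^ 2 = L ^ 2).
{ rewrite Rpow_mult_distr, h; field; lra. }
assert (0 < s * z) by (apply Rmult_lt_0_compat; lra).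
assert (s * z = L) by nra.
apply (Rmult_eq_reg_l s); [|lra]; rewrite H0; field; lra.
Qed.

(** * Amounts held in each kind of pool at a given price *)

Lemma cp_liquidity_eq (x y m : R) : 0 <= m -> x * y = m ^ 2 -> cp_liquidity x y = m.
Proof. intros hm h; unfold cp_liquidity; rewrite h; apply sqrt_pow2, hm. Qed.

(** The [+ 0] and [- 0] give the shape expected by [marginal_price_hyperbola]. *)
Lemma cp_curve_hyperbola (L x y : R) :
  0 < L -> 0 < y -> (cp_curve L x y <-> x = L ^ 2 / (y + 0) - 0).
Proof.
intros hL hy; split.
- intros [hx [_ h]].
  assert (hxy : x * y = L ^ 2).
  { unfold cp_liquidity in h; rewrite <- h, pow2_sqrt; nra. }
  rewrite <- hxy; field; lra.
- intros ->.
  assert (0 < L ^ 2 / y) by (apply Rdiv_lt_0_compat; nra).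
  rewrite Rplus_0_r, Rminus_0_r.
  split; [assumption|split; [assumption|]].
  apply cp_liquidity_eq; [lra|field; lra].
Qed.

(** Writing the price as [s ^ 2] makes the amounts rational in [s]. *)
Lemma cp_holds_iff (L s x y : R) :
  0 < L -> 0 < s -> (cp_holds L (s ^ 2) x y <-> x = L * s /\ y = L / s).
Proof.
intros hL hs.
assert (hmp : 0 < y -> cp_curve L x y ->
  (marginal_price (cp_curve L) x y (s ^ 2) <-> s ^ 2 = L ^ 2 / (y + 0) ^ 2)).
{ intros hy hc; apply marginal_price_hyperbola with (c := 0); [lra| |exact hc].
  generalize (open_gt 0 y hy); apply filter_imp.
  intros t ht z; apply cp_curve_hyperbola; assumption. }
split.
- intros [hc hm].
  assert (hy : 0 < y) by apply hc.
  apply hmp in hm; [|exact hy|exact hc]; rewrite Rplus_0_r in hm.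
  assert (hyE : y = L / s) by (apply sqr_div_sqr_unique; assumption).
  apply cp_curve_hyperbola in hc; [|assumption..].
  split; [|exact hyE].
  rewrite hc, hyE; field; lra.
- intros [hx hy].
  assert (hy0 : 0 < y) by (rewrite hy; apply Rdiv_lt_0_compat; assumption).
  assert (hc : cp_curve L x y).
  { apply cp_curve_hyperbola; [assumption..|]; rewrite hx, hy; field; lra. }
  split; [exact hc|].
  apply hmp; [assumption..|]; rewrite hy; field; lra.
Qed.

(** The virtual reserves [x + L * a] and [y + L / b] move like a constant product pool of liquidity
    [L], hence equal [L * s] and [L / s]. The bounds on [s] make the real amounts nonnegative. *)
Lemma cl_holds_iff (L a b s x y : R) :
  0 < L -> 0 < a -> 0 < b -> a <= s <= b ->
  (cl_holds L (a ^ 2) (b ^ 2) (s ^ 2) x y <->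
   x = L * s - L * a /\ y = L / s - L / b).
Proof.
intros hL ha hb hs.
assert (hLb : 0 < L / b) by (apply Rdiv_lt_0_compat; assumption).
assert (hcurve : forall z t, 0 < t + L / b ->
  (cl_curve L (a ^ 2) (b ^ 2) z t <-> z = L ^ 2 / (t + L / b) - L * a)).
{ intros z t ht; unfold cl_curve; rewrite !sqrt_pow2 by lra; split.
  - intros <-; field; split; [lra|].
    (* The side condition left by [field] is [t * b + L <> 0]; otherwise [t + L / b] would
       vanish. *)
    intros h; apply (Rlt_irrefl 0); revert ht.
    replace (t + L / b) with ((t * b + L) / b) by (field; lra).
    rewrite h; unfold Rdiv; rewrite Rmult_0_l; trivial.
  - intros ->; unfold Rminus.
    rewrite Rplus_assoc, Rplus_opp_l, Rplus_0_r.
    unfold Rdiv at 1; rewrite Rmult_assoc, Rinv_l by lra; ring. }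
assert (hmp : 0 < y + L / b -> cl_curve L (a ^ 2) (b ^ 2) x y ->
  (marginal_price (cl_curve L (a ^ 2) (b ^ 2)) x y (s ^ 2)
   <-> s ^ 2 = L ^ 2 / (y + L / b) ^ 2)).
{ intros hy hc; apply marginal_price_hyperbola with (c := L * a);
    [lra| |exact hc].
  assert (hy' : - (L / b) < y) by lra.
  generalize (open_gt _ y hy'); apply filter_imp.
  intros t ht z; apply hcurve; lra. }
split.
- intros [hx [hy [hc hm]]].
  assert (hyb : 0 < y + L / b) by lra.
  apply hmp in hm; [|assumption..].
  assert (hyE : y + L / b = L / s) by (apply sqr_div_sqr_unique; lra).
  apply hcurve in hc; [|assumption].
  split; [|lra].
  rewrite hc, hyE; field; lra.
- intros [hx hy].
  assert (hyE : y + L / b = L / s) by lra.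
  assert (hyb : 0 < y + L / b)
    by (rewrite hyE; apply Rdiv_lt_0_compat; lra).
  assert (hc : cl_curve L (a ^ 2) (b ^ 2) x y).
  { apply hcurve; [assumption|]; rewrite hx, hyE; field; lra. }
  assert (hx0 : 0 <= L * (s - a)) by (apply Rmult_le_pos; lra).
  split; [lra|split; [|split; [exact hc|]]].
  + assert (L / b <= L / s)
      by (apply Rmult_le_compat_l; [lra|apply Rinv_le_contravar; lra]).
    lra.
  + apply hmp; [assumption..|]; rewrite hyE; field; lra.
Qed.

(** * Deposits, divergence loss and liquidation *)

Lemma cp_deposit_iff (s x y : R) :
  0 < s -> (cp_deposit (s ^ 2) x y <-> 0 < y /\ x = s ^ 2 * y).
Proof.
intros hs; unfold cp_deposit; split.
- intros [hx [hy <-]]; split; [exact hy|field; lra].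
- intros [hy ->]; split; [|split; [exact hy|field; lra]].
  apply Rmult_lt_0_compat; [apply pow_lt, hs|exact hy].
Qed.

(** Serves the borrowed deposit, and with [l = 1] an unscaled deposit. *)
Lemma cp_liquidity_deposit (s x y l : R) :
  0 < s -> 0 < l -> cp_deposit (s ^ 2) x y ->
  cp_liquidity (l * x) (l * y) = l * (s * y).
Proof.
intros hs hl h; apply cp_deposit_iff in h; [|exact hs]; destruct h as [hy ->].
apply cp_liquidity_eq; [|ring].
apply Rlt_le, Rmult_lt_0_compat, Rmult_lt_0_compat; assumption.
Qed.

(* Value and ratio determine a deposit, so assets that are already in the
   deposit ratio are compared with themselves. *)
Lemma capital_efficiency_iff (s L x y e : R) :
  0 < s -> cp_deposit (s ^ 2) x y ->
  (capital_efficiency (s ^ 2) L x y e <-> e = L / cp_liquidity x y).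
Proof.
intros hs h; split.
- intros [u [v [huv [hval ->]]]].
  apply cp_deposit_iff in h, huv; [|exact hs..].
  destruct h as [hy ->], huv as [hv ->].
  unfold asset_value in hval.
  assert (hs2 : 0 < s ^ 2) by nra.
  assert (v = y) by nra.
  subst v; reflexivity.
- intros ->; exists x, y; auto.
Qed.

(** With [L = l * s0 * y], the pool position is worth [2 * L * s] at price [s ^ 2] and the untouched
    deposit [l * y * (s0 ^ 2 + s ^ 2)]; the difference is a perfect square. *)
Lemma divergence_loss_iff (s0 s l x y d : R) :
  0 < s0 -> 0 < s -> 0 < l -> cp_deposit (s0 ^ 2) x y ->
  (divergence_loss (l * x) (l * y) (s ^ 2) d <-> d = l * y * (s - s0) ^ 2).
Proof.
intros hs0 hs hl h; unfold divergence_loss.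
rewrite (cp_liquidity_deposit _ _ _ _ hs0 hl h).
apply cp_deposit_iff in h; [|exact hs0]; destruct h as [hy ->].
assert (hL : 0 < l * (s0 * y)) by (repeat apply Rmult_lt_0_compat; assumption).
unfold asset_value; split.
- intros [a1 [b1 [h ->]]].
  apply cp_holds_iff in h; [|assumption..]; destruct h as [-> ->].
  field; lra.
- intros ->; exists (l * (s0 * y) * s), (l * (s0 * y) / s); split.
  + apply cp_holds_iff; auto.
  + field; lra.
Qed.

(** The loss exists and is unique, so the negated existential is an inequality, in which the common
    factor [y] cancels. *)
Lemma not_liquidated_iff (s0 s l x y : R) :
  0 < s0 -> 0 < s -> 0 < l -> cp_deposit (s0 ^ 2) x y ->
  (~ liquidated l x y (s ^ 2) <-> l * (s - s0) ^ 2 <= s0 ^ 2 + s ^ 2).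
Proof.
intros hs0 hs hl h.
destruct (proj1 (cp_deposit_iff _ _ _ hs0) h) as [hy hx].
assert (hv : asset_value (s ^ 2) x y = (s0 ^ 2 + s ^ 2) * y).
{ unfold asset_value; rewrite hx; ring. }
unfold liquidated; rewrite hv; split.
- intros hn; apply Rnot_lt_le; intros hlt; apply hn.
  exists (l * y * (s - s0) ^ 2); split.
  + apply (divergence_loss_iff s0); auto.
  + apply (Rmult_lt_compat_r y) in hlt; lra.
- intros hle [d [hd hgt]].
  apply (divergence_loss_iff s0) in hd; [|assumption..].
  apply (Rmult_le_compat_r y) in hle; lra.
Qed.

Lemma margin_stays_open_iff (a b l x y : R) :
  0 < a -> a < b -> 0 < l -> cp_deposit ((a * b) ^ 2) x y ->
  (margin_stays_open ((a * b) ^ 2) l x y (a ^ 4) (b ^ 4) <->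
   l <= (a ^ 2 + b ^ 2) / (b - a) ^ 2).
Proof.
intros ha hab hl h.
assert (hs0 : 0 < a * b) by nra.
assert (hba : 0 < (b - a) ^ 2) by nra.
assert (ha2 : 0 < a ^ 2) by nra.
assert (hab2 : a ^ 2 < b ^ 2) by nra.
split.
- intros [_ hopen].
  (* The lower end price alone forces the bound: both sides carry a factor [a ^ 2], leaving
     [l * (b - a) ^ 2 <= a ^ 2 + b ^ 2]. *)
  assert (hle : l * (a ^ 2 - a * b) ^ 2 <= (a * b) ^ 2 + (a ^ 2) ^ 2).
  { apply (not_liquidated_iff _ _ _ x y); try assumption.
    replace ((a ^ 2) ^ 2) with (a ^ 4) by ring.
    apply hopen; split; [lra|].
    apply pow_incr; lra. }
  apply Rle_div_r; [exact hba|].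
  apply (Rmult_le_reg_l (a ^ 2)); [exact ha2|lra].
- intros hle; split; [exact h|].
  apply Rle_div_r in hle; [|exact hba].
  intros p1 [h1 h2].
  assert (hp1 : 0 < p1) by (apply Rlt_le_trans with (2 := h1), pow_lt; exact ha).
  set (s := sqrt p1).
  assert (hs : 0 < s) by (apply sqrt_lt_R0; exact hp1).
  assert (hp1s : p1 = s ^ 2) by (symmetry; apply pow2_sqrt; lra).
  clearbody s; subst p1.
  assert (h1' : a ^ 2 <= s) by (apply Rnot_lt_le; intros hlt; nra).
  assert (h2' : s <= b ^ 2) by (apply Rnot_lt_le; intros hlt; nra).
  apply (not_liquidated_iff (a * b)); try assumption.
  apply (Rmult_le_reg_l _ _ _ hba).
  apply Rle_trans with ((a ^ 2 + b ^ 2) * (s - a * b) ^ 2).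
  + rewrite <- Rmult_assoc, (Rmult_comm _ l).
    apply Rmult_le_compat_r; [apply pow2_ge_0|exact hle].
  (* This product is exactly the gap [(b - a) ^ 2 * ((a * b) ^ 2 + s ^ 2) - (a ^ 2 + b ^ 2) * (s - a
     * b) ^ 2]; it vanishes at both ends of the range. *)
  + assert (0 <= 2 * (a * b) * ((s - a ^ 2) * (b ^ 2 - s))).
    { apply Rmult_le_pos; [lra|apply Rmult_le_pos; lra]. }
    lra.
Qed.

(** * The two efficiency results in terms of fourth roots *)

(** Existence keeps the universal claim from being vacuous. Since the held amounts are already in
    deposit ratio, they serve as their own reference deposit. *)
Lemma cl_efficiency (a b L : R) :
  0 < a -> a < b -> 0 < L ->
  (exists x y : R, cl_holds L (a ^ 4) (b ^ 4) ((a * b) ^ 2) x y) /\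
  (forall x y : R, cl_holds L (a ^ 4) (b ^ 4) ((a * b) ^ 2) x y ->
     cp_deposit ((a * b) ^ 2) x y /\
     cp_liquidity x y / L = 1 - a / b /\
     capital_efficiency ((a * b) ^ 2) L x y (1 / (1 - a / b))).
Proof.
intros ha hab hL.
assert (hs0 : 0 < a * b) by nra.
assert (hiff : forall x y, cl_holds L (a ^ 4) (b ^ 4) ((a * b) ^ 2) x y <->
  x = L * (a * b) - L * a ^ 2 /\ y = L / (a * b) - L / b ^ 2).
{ intros x y.
  replace (a ^ 4) with ((a ^ 2) ^ 2) by ring.
  replace (b ^ 4) with ((b ^ 2) ^ 2) by ring.
  apply cl_holds_iff; nra. }
split.
- exists (L * (a * b) - L * a ^ 2), (L / (a * b) - L / b ^ 2).
  apply hiff; auto.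
- intros x y h; apply hiff in h; destruct h as [hx hy].
  assert (hyE : y = L * (b - a) / (a * b ^ 2)) by (rewrite hy; field; lra).
  assert (hy0 : 0 < y).
  { rewrite hyE; apply Rdiv_lt_0_compat; [nra|].
    apply Rmult_lt_0_compat; nra. }
  assert (hd : cp_deposit ((a * b) ^ 2) x y).
  { apply cp_deposit_iff; [exact hs0|split; [exact hy0|]].
    rewrite hx, hyE; field; lra. }
  assert (hliq : cp_liquidity x y = L * (1 - a / b)).
  { rewrite <- (Rmult_1_l x), <- (Rmult_1_l y).
    rewrite (cp_liquidity_deposit (a * b)) by (assumption || lra).
    rewrite hyE; field; lra. }
  split; [exact hd|split].
  + rewrite hliq; field; lra.
  + apply capital_efficiency_iff; [assumption..|].
    rewrite hliq; field; repeat split; lra.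
Qed.

(** Liquidity is homogeneous of degree one, so capital efficiency equals the leverage [l] and both
    maxima coincide. *)
Lemma margin_efficiency (a b dx dy : R) :
  0 < a -> a < b -> cp_deposit ((a * b) ^ 2) dx dy ->
  is_maximum
    (fun l : R => 1 < l /\
       margin_stays_open ((a * b) ^ 2) l dx dy (a ^ 4) (b ^ 4))
    ((a ^ 2 + b ^ 2) / (b - a) ^ 2) /\
  is_maximum
    (fun e : R => exists l : R,
       1 < l /\ margin_stays_open ((a * b) ^ 2) l dx dy (a ^ 4) (b ^ 4) /\
       capital_efficiency ((a * b) ^ 2) (cp_liquidity (l * dx) (l * dy)) dx dy e)
    ((a ^ 2 + b ^ 2) / (b - a) ^ 2).
Proof.
intros ha hab hd.
assert (hs0 : 0 < a * b) by nra.
(* The numerator exceeds the denominator by [2 * a * b], so the bound is itself an admissible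
   leverage. *)
assert (hm1 : 1 < (a ^ 2 + b ^ 2) / (b - a) ^ 2).
{ apply Rlt_div_r; nra. }
set (m := (a ^ 2 + b ^ 2) / (b - a) ^ 2) in *.
assert (hopen : forall l, 1 < l ->
  (margin_stays_open ((a * b) ^ 2) l dx dy (a ^ 4) (b ^ 4) <-> l <= m)).
{ intros l hl; apply margin_stays_open_iff; assumption || lra. }
assert (heff : forall l e, 1 < l ->
  (capital_efficiency ((a * b) ^ 2) (cp_liquidity (l * dx) (l * dy)) dx dy e
   <-> e = l)).
{ intros l e hl; rewrite capital_efficiency_iff by assumption.
  replace (cp_liquidity (l * dx) (l * dy) / cp_liquidity dx dy) with l;
    [reflexivity|].
  rewrite <- (Rmult_1_l dx) at 2; rewrite <- (Rmult_1_l dy) at 2.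
  rewrite !(cp_liquidity_deposit (a * b)) by (assumption || lra).
  destruct hd as [_ [hy _]]; field; lra. }
split; split.
- split; [exact hm1|apply hopen; lra].
- intros l [hl ho]; apply hopen; assumption.
- exists m; split; [exact hm1|split; [apply hopen; lra|apply heff; auto]].
- intros e [l [hl [ho he]]].
  apply heff in he; [|exact hl]; subst e; apply hopen; assumption.
Qed.

(** * From real powers to fourth roots *)

Lemma Rpower_pow_cancel (x : R) (n m : nat) (r : R) :
  0 < x -> INR n * r = INR m -> Rpower (x ^ n) r = x ^ m.
Proof.
intros hx h.
rewrite <- !Rpower_pow, Rpower_mult, h by exact hx; reflexivity.
Qed.

Theorem mainTheorem1 (pl pu : R) (hpl : 0 < pl) (hlu : pl < pu) :
  let pb := sqrt (pl * pu) in
  let l_max :=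
    (Rpower (pu / pl) (1 / 2) + 1) / (Rpower (pu / pl) (1 / 4) - 1) ^ 2 in
  (forall L : R, 0 < L ->
     (exists x y : R, cl_holds L pl pu pb x y) /\
     (forall x y : R, cl_holds L pl pu pb x y ->
        cp_deposit pb x y /\
        cp_liquidity x y / L = 1 - Rpower (pl / pu) (1 / 4) /\
        capital_efficiency pb L x y (1 / (1 - Rpower (pl / pu) (1 / 4)))))
  /\
  (forall dx dy : R, cp_deposit pb dx dy ->
     is_maximum
       (fun l : R => 1 < l /\ margin_stays_open pb l dx dy pl pu) l_max /\
     is_maximum
       (fun e : R => exists l : R,
          1 < l /\ margin_stays_open pb l dx dy pl pu /\
          capital_efficiency pb (cp_liquidity (l * dx) (l * dy)) dx dy e)
       l_max).
Proof.
intros pb l_max.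
assert (hroot : forall q, 0 < q -> q = Rpower q (1 / 4) ^ 4).
{ intros q hq; rewrite <- Rpower_pow by apply exp_pos.
  rewrite Rpower_mult; replace (1 / 4 * INR 4) with 1 by (simpl; field).
  symmetry; apply Rpower_1, hq. }
pose proof (hroot pl hpl) as ea.
pose proof (hroot pu (Rlt_trans _ _ _ hpl hlu)) as eb.
assert (ha : 0 < Rpower pl (1 / 4)) by apply exp_pos.
assert (hab : Rpower pl (1 / 4) < Rpower pu (1 / 4))
  by (apply Rlt_Rpower_l; lra).
set (a := Rpower pl (1 / 4)) in *; set (b := Rpower pu (1 / 4)) in *.
clearbody a b.
assert (hpb : pb = (a * b) ^ 2).
{ unfold pb; rewrite ea, eb.
  replace (a ^ 4 * b ^ 4) with (((a * b) ^ 2) ^ 2) by ring.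
  apply sqrt_pow2, pow2_ge_0. }
assert (hratio : forall u v, 0 < u -> 0 < v -> u ^ 4 / v ^ 4 = (u / v) ^ 4)
  by (intros u v hu hv; field; lra).
assert (hba0 : 0 < b / a) by (apply Rdiv_lt_0_compat; lra).
assert (hab0 : 0 < a / b) by (apply Rdiv_lt_0_compat; lra).
assert (hmin : Rpower (pl / pu) (1 / 4) = a / b).
{ rewrite ea, eb, hratio by lra.
  rewrite (Rpower_pow_cancel _ _ 1) by (assumption || (simpl; field)); ring. }
(* Here [pu / pl = (b / a) ^ 4], so [l_max] is rational in [b / a]; clearing [a ^ 2] gives the
   symmetric form. *)
assert (hmax : l_max = (a ^ 2 + b ^ 2) / (b - a) ^ 2).
{ unfold l_max; rewrite ea, eb, hratio by lra.
  rewrite (Rpower_pow_cancel _ _ 2) by (assumption || (simpl; field)).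
  rewrite (Rpower_pow_cancel _ _ 1) by (assumption || (simpl; field)).
  field; lra. }
rewrite hmin, hmax, hpb; clear hmin hmax hpb l_max pb.
subst pl pu; split.
- intros L hL; apply cl_efficiency; assumption.
- intros dx dy hd; apply margin_efficiency; assumption.
Qed.
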